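(* Let $n\ge1$, let $A\in\widehat{\mathbb F_q}$ and $x_1,\ldots,x_n\in\mathbb F_q$. Then $$A(1+x_1+\cdots+x_n)=\delta(x_1)\cdots\delta(x_n)+\sum_{k=1}^{n}\frac{1}{(q-1)^k}\sum_{1\le r_1<\cdots<r_k\le n}\delta_{r_1\cdots r_k}\sum_{\chi_1,\ldots,\chi_k\in\widehat{\mathbb F_q}}J(A,\overline{\chi_1},\ldots,\overline{\chi_k})\,\chi_1(-x_{r_1})\cdots\chi_k(-x_{r_k}).$$
   Context: Let $p$ be an odd prime, $q=p^r$ with $r\ge1$, and $\mathbb F_q$ the field with $q$ elements. $\widehat{\mathbb F_q}$ is the group of multiplicative characters $\chi:\mathbb F_q^\times\to\mathbb C^\times$, each (including the trivial one) extended to $\mathbb F_q$ by $\chi(0)=0$; $\overline{\chi}$ is the inverse of $\chi$. $\delta(x)=1$ if $x=0$ and $\delta(x)=0$ otherwise. For $1\le r_1<\cdots<r_k\le n$, $\delta_{r_1\cdots r_k}=\prod_{1\le i\le n,\ i\ne r_1,\ldots,r_k}\delta(x_i)$, with $\delta_{r_1\cdots r_n}=1$ when $k=n$. The multiple Jacobi sum is $J(\lambda_1,\ldots,\lambda_m)=\sum_{c_1,\ldots,c_m\in\mathbb F_q,\ c_1+\cdots+c_m=1}\lambda_1(c_1)\cdots\lambda_m(c_m)$ for $\lambda_1,\ldots,\lambda_m\in\widehat{\mathbb F_q}$. *)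

(* Defs.v *)
From HB Require Import structures.
From mathcomp Require Import all_boot all_order all_algebra all_fingroup.
From mathcomp Require Import cyclic reals complex.

Set Implicit Arguments.
Unset Strict Implicit.
Unset Printing Implicit Defensive.

Import GRing.Theory.
Local Open Scope ring_scope.

Section MultiplicativeCharacters.

Variables (F : finFieldType) (C : numClosedFieldType).

Definition is_hom_to_units (f : {ffun {unit F} -> C}) : bool :=
  [forall u, f u != 0] && [forall u, forall v, f (u * v)%g == f u * f v].

Record mchar := MChar {
  mchar_fun : {ffun {unit F} -> C};
  mchar_hom : is_hom_to_units mchar_fun
}.

HB.instance Definition _ := [isSub for mchar_fun].

Lemma mchar_neq0 (chi : mchar) u : mchar_fun chi u != 0.
Proof. by have /andP[/forallP + _] := mchar_hom chi; apply. Qed.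

Lemma mcharM (chi : mchar) u v :
  mchar_fun chi (u * v)%g = mchar_fun chi u * mchar_fun chi v.
Proof.
by have /andP[_ /forallP/(_ u)/forallP/(_ v)/eqP] := mchar_hom chi.
Qed.

Lemma mchar1 (chi : mchar) : mchar_fun chi 1%g = 1.
Proof.
by apply: (mulfI (mchar_neq0 chi 1%g)); rewrite -mcharM mulg1 mulr1.
Qed.

Lemma mcharX (chi : mchar) u n :
  mchar_fun chi (u ^+ n)%g = mchar_fun chi u ^+ n.
Proof.
elim: n => [|n IHn]; first by rewrite expg0 expr0 mchar1.
by rewrite expgS exprS mcharM IHn.
Qed.

(* There are finitely many characters: all their values are roots of unity
   of order dividing #|{unit F}|. *)
Let N := #|[set: {unit F}]|.

Definition unity_values : seq C := sval (closed_field_poly_normal ('X^N - 1)).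

Lemma mem_unity_values (chi : mchar) u : mchar_fun chi u \in unity_values.
Proof.
have N_gt0 : (0 < N)%N by apply: cardG_gt0.
rewrite /unity_values; case: closed_field_poly_normal => s /= Es.
have: root ('X^N - 1) (mchar_fun chi u).
  rewrite rootE !hornerE -mcharX.
  by rewrite expg_cardG ?inE // mchar1 subrr.
by rewrite Es (monicP (monicXnsubC 1 N_gt0)) scale1r root_prod_XsubC.
Qed.

Definition mchar_encode (chi : mchar) : {ffun {unit F} -> seq_sub unity_values} :=
  [ffun u => SeqSub (mem_unity_values chi u)].

Definition mchar_decode (t : {ffun {unit F} -> seq_sub unity_values}) :
  option mchar := insub [ffun u => val (t u)].

Lemma mchar_encodeK : pcancel mchar_encode mchar_decode.
Proof.
move=> chi; rewrite /mchar_decode; set f := finfun _.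
suff -> : f = val chi by rewrite valK.
by apply/ffunP => u; rewrite !ffunE.
Qed.

HB.instance Definition _ := Countable.copy mchar (pcan_type mchar_encodeK).
HB.instance Definition _ : isFinite mchar := PCanIsFinite mchar_encodeK.

Lemma mchar_one_hom : is_hom_to_units [ffun=> 1].
Proof.
apply/andP; split; first by apply/forallP=> u; rewrite ffunE oner_eq0.
by apply/forallP=> u; apply/forallP=> v; rewrite !ffunE mulr1.
Qed.

Lemma mchar_mul_hom (chi psi : mchar) :
  is_hom_to_units [ffun u => mchar_fun chi u * mchar_fun psi u].
Proof.
apply/andP; split.
  by apply/forallP=> u; rewrite ffunE mulf_neq0 ?mchar_neq0.
by apply/forallP=> u; apply/forallP=> v; rewrite !ffunE !mcharM mulrACA.
Qed.

Lemma mchar_inv_hom (chi : mchar) :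
  is_hom_to_units [ffun u => (mchar_fun chi u)^-1].
Proof.
apply/andP; split.
  by apply/forallP=> u; rewrite ffunE invr_eq0 mchar_neq0.
by apply/forallP=> u; apply/forallP=> v; rewrite !ffunE mcharM invfM.
Qed.

Definition mchar_one := MChar mchar_one_hom.
Definition mchar_mul chi psi := MChar (mchar_mul_hom chi psi).
Definition mchar_inv chi := MChar (mchar_inv_hom chi).

Lemma mchar_mulA : associative mchar_mul.
Proof.
by move=> a b c; apply/val_inj/ffunP => u; rewrite !ffunE mulrA.
Qed.

Lemma mchar_mul1 : left_id mchar_one mchar_mul.
Proof. by move=> a; apply/val_inj/ffunP => u; rewrite !ffunE mul1r. Qed.

Lemma mchar_mulV : left_inverse mchar_one mchar_inv mchar_mul.
Proof.
by move=> a; apply/val_inj/ffunP => u; rewrite !ffunE mulVf ?mchar_neq0.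
Qed.

HB.instance Definition _ :=
  Finite_isGroup.Build mchar mchar_mulA mchar_mul1 mchar_mulV.

(* Every character, including the trivial one, is extended by chi 0 = 0. *)
Definition mchar_ext (chi : mchar) (a : F) : C :=
  if insub a : option {unit F} is Some u then mchar_fun chi u else 0.

Definition jacobi_sum m (lambda : m.-tuple mchar) : C :=
  \sum_(c : {ffun 'I_m -> F} | \sum_i c i == 1)
     \prod_(i < m) mchar_ext (tnth lambda i) (c i).

Definition delta (a : F) : C := (a == 0)%:R.

Definition delta_off n (x : 'I_n -> F) k (s : k.-tuple 'I_n) : C :=
  \prod_(i < n | i \notin s) delta (x i).

End MultiplicativeCharacters.

Coercion mchar_ext : mchar >-> Funclass.

Arguments delta {F} C a.
Arguments delta_off {F} C {n} x {k} s.

(* Main.v *)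
(* Character sums vanish off the support of x, and the delta's vanish unless the
   indices r_1, ..., r_k contain it, so only the support itself contributes.
   There, orthogonality of characters in each chi_i forces c_i = - x_(r_i) in
   the Jacobi sum, leaving c_0 = 1 + x_1 + ... + x_n. *)
Require Import Defs.
From HB Require Import structures.
From mathcomp Require Import all_boot all_order all_algebra all_fingroup.
From mathcomp Require Import cyclic separable cyclotomic.
From mathcomp Require Import reals complex.

Set Implicit Arguments.
Unset Strict Implicit.
Unset Printing Implicit Defensive.

Import GRing.Theory Num.Theory.
Local Open Scope ring_scope.

(** In characteristic 0 the polynomial ['X^n - 1] is separable, so it has n distinct roots in [C]; a
    field with n distinct n-th roots of unity contains a primitive one. *)
Lemma exists_prim_root (C : numClosedFieldType) n :
  (0 < n)%N -> exists z : C, n.-primitive_root z.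
Proof.
move=> n_gt0; have [s Es] := closed_field_poly_normal ('X^n - 1 : {poly C}).
rewrite (monicP (monicXnsubC 1 n_gt0)) scale1r in Es.
have size_s : size s = n.
  by apply: succn_inj; rewrite -(size_prod_XsubC s id) -Es size_XnsubC.
have uniq_s : uniq s.
  by rewrite -separable_prod_XsubC -Es separable_Xn_sub_1 // pnatr_eq0 -lt0n.
have : has n.-primitive_root s.
  apply: has_prim_root => //; last by rewrite size_s.
  by apply/allP => z sz; rewrite /root_of_unity Es root_prod_XsubC.
by case/hasP => z _ prim_z; exists z.
Qed.

Section Orthogonality.

Variables (F : finFieldType) (C : numClosedFieldType).
Implicit Types (chi : mchar F C) (u v : {unit F}).

(** The unit group is cyclic, and sending a generator to a primitive root of unity of the same order
    defines a faithful character, which serves for every [u] at once. *)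
Lemma mchar_separates u : u != 1%g -> exists chi, mchar_fun chi u != 1.
Proof.
move=> u_neq1; have /cyclicP[g Eg] := field_unit_group_cyclic [set: {unit F}]%G.
have [z prim_z] := exists_prim_root C (order_gt0 g).
(* A discrete logarithm to base [g]. Its values matter only modulo the order of [g], so
   multiplicativity of [z ^+ l v] comes from a congruence of exponents. *)
have [l Dl] : exists l, forall v, v = (g ^+ l v)%g.
  apply: (@fin_all_exists _ _ (fun v k => v = (g ^+ k)%g)) => v.
  by apply/cycleP; rewrite -Eg inE.
have l_hom : is_hom_to_units [ffun v => z ^+ l v].
  apply/andP; split; apply/forallP => v.
    by rewrite ffunE expf_neq0 // (prim_root_eq0 prim_z) -lt0n order_gt0.
  apply/forallP => w; rewrite !ffunE -exprD (eq_prim_root_expr prim_z).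
  by rewrite -eq_expg_mod_order expgD -!Dl.
exists (MChar l_hom); rewrite /= ffunE.
apply: contra u_neq1; rewrite -(prim_order_dvd prim_z) order_dvdn => /eqP.
by rewrite -Dl => ->.
Qed.

(** Multiplication by a character [psi] with [psi u] different from 1 permutes the characters, so
    the sum equals [psi u] times itself. *)
Lemma sum_mchar_neq1 u : u != 1%g -> \sum_(chi : mchar F C) mchar_fun chi u = 0.
Proof.
move=> /mchar_separates[psi psi_neq1]; apply/eqP.
have : (mchar_fun psi u - 1) * (\sum_(chi : mchar F C) mchar_fun chi u) == 0.
  rewrite mulrBl mul1r subr_eq0 mulr_sumr.
  rewrite [eqbRHS](reindex_inj (mulgI psi)) /=; apply/eqP.
  by apply: eq_bigr => chi _; rewrite ffunE.
by rewrite mulf_eq0 subr_eq0 (negPf psi_neq1).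
Qed.

(** The dual argument: translation by a unit [v] where [chi] is not 1 permutes the units. *)
Lemma sum_unit_neq1 chi : chi != 1%g -> \sum_u mchar_fun chi u = 0.
Proof.
move=> chi_neq1; have [v chiv] : exists v, mchar_fun chi v != 1.
  apply/existsP; apply: contraR chi_neq1; rewrite negb_exists => /forallP chi1.
  apply/eqP/val_inj/ffunP => v; rewrite [RHS]ffunE.
  by apply/eqP; rewrite -[_ == _]negbK chi1.
apply/eqP; have : (mchar_fun chi v - 1) * (\sum_u mchar_fun chi u) == 0.
  rewrite mulrBl mul1r subr_eq0 mulr_sumr.
  rewrite [eqbRHS](reindex_inj (mulgI v)) /=; apply/eqP.
  by apply: eq_bigr => u _; rewrite mcharM.
by rewrite mulf_eq0 subr_eq0 (negPf chiv).
Qed.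

(* Both sides are the sum of all values chi u, taken in the two orders. *)
Lemma card_mchar : #|{: mchar F C}|%:R = #|{: {unit F}}|%:R :> C.
Proof.
transitivity (\sum_(u : {unit F}) \sum_(chi : mchar F C) mchar_fun chi u).
  rewrite (bigD1 1%g) //= [X in _ + X]big1 ?addr0; last first.
    by move=> u; apply: sum_mchar_neq1.
  by rewrite (eq_bigr (fun=> 1)) ?sumr_const // => chi _; rewrite mchar1.
rewrite exchange_big (bigD1 1%g) //= [X in _ + X]big1 ?addr0; last first.
  by move=> chi; apply: sum_unit_neq1.
by rewrite (eq_bigr (fun=> 1)) ?sumr_const // => u _; rewrite ffunE.
Qed.

Lemma mchar_ext0 chi : chi 0 = 0.
Proof. by rewrite /mchar_ext insubF ?unitr0. Qed.

Lemma mchar_ext_val chi u : chi (val u) = mchar_fun chi u.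
Proof. by rewrite /mchar_ext valK. Qed.

Lemma mchar_ext1 chi : chi 1 = 1.
Proof. by rewrite -(mchar1 chi) -mchar_ext_val. Qed.

(** For nonzero [a] the summand is the value of [chi] at b/a. The case a = b = 0 must be excluded:
    there every summand is 0 by the convention [chi 0 = 0]. *)
Lemma mchar_orthogonality (a b : F) : b != 0 ->
  \sum_(chi : mchar F C) (chi^-1)%g a * chi b = (#|F|%:R - 1) * (a == b)%:R.
Proof.
move=> b_neq0; have [->|a_neq0] := eqVneq a 0.
  rewrite eq_sym (negPf b_neq0) mulr0 big1 // => chi _.
  by rewrite mchar_ext0 mul0r.
have [u ->] : exists u : {unit F}, a = val u.
  by rewrite -unitfE in a_neq0; exists (Sub a a_neq0).
have [v ->] : exists v : {unit F}, b = val v.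
  by rewrite -unitfE in b_neq0; exists (Sub b b_neq0).
have -> : #|F|%:R - 1 = #|{: {unit F}}|%:R :> C.
  rewrite -(cardsT {unit F}) card_finField_unit -subn1 natrB //.
  by apply/card_gt0P; exists 0.
rewrite (inj_eq val_inj) eq_sym.
transitivity (\sum_(chi : mchar F C) mchar_fun chi (u^-1 * v)%g).
  apply: eq_bigr => chi _; rewrite !mchar_ext_val mcharM ffunE; congr (_ * _).
  apply: (mulfI (mchar_neq0 chi u)).
  by rewrite divff ?mchar_neq0 // -mcharM mulgV mchar1.
have [->|v_neq] := eqVneq v u.
  rewrite mulVg mulr1 -card_mchar (eq_bigr (fun=> 1)) ?sumr_const // => chi _.
  exact: mchar1.
by rewrite mulr0 sum_mchar_neq1 // -eq_mulVg1 eq_sym.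
Qed.

Lemma sum_jacobi_sum k (A : mchar F C) (y : 'I_k -> F) :
    (forall i, y i != 0) ->
  \sum_(chi : k.-tuple (mchar F C))
     jacobi_sum [tuple of A :: [seq (psi^-1)%g | psi <- chi]] *
     \prod_(i < k) (tnth chi i) (- y i) =
  (#|F|%:R - 1) ^+ k * A (1 + \sum_(i < k) y i).
Proof.
move=> y_neq0.
(* With the sum over [c] outermost, the character sums separate by index. Coordinate [ord0] of [c]
   belongs to [A], and coordinate [lift ord0 i] to the i-th character. *)
transitivity (\sum_(c : {ffun 'I_k.+1 -> F} | \sum_i c i == 1)
   A (c ord0) * \prod_(i < k) ((#|F|%:R - 1) * (c (lift ord0 i) == - y i)%:R)).
  under eq_bigr do rewrite mulr_suml.
  rewrite exchange_big; apply: eq_bigr => c _.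
  under [in RHS]eq_bigr => i _ do
    rewrite -(mchar_orthogonality (c (lift ord0 i))) ?oppr_eq0 //.
  rewrite bigA_distr_bigA mulr_sumr.
  (* Distributing the product over the sums produces finite functions, which are matched here with
     tuples. *)
  rewrite [RHS](reindex (fun chi : k.-tuple (mchar F C) => [ffun i => tnth chi i])).
    apply: eq_bigr => chi _; rewrite big_ord_recl tnth0 -mulrA; congr (_ * _).
    rewrite -big_split; apply: eq_bigr => i _.
    by rewrite tnthS tnth_map ffunE.
  exists (fun f : {ffun 'I_k -> mchar F C} => [tuple f i | i < k]) => f _.
    by apply: eq_from_tnth => i; rewrite tnth_mktuple ffunE.
  by apply/ffunP => i; rewrite ffunE tnth_mktuple.
(* The only point where no Kronecker factor vanishes: these factors fix the tail, and the constraint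
   that the coordinates sum to 1 then fixes the head. *)
pose c0 : {ffun 'I_k.+1 -> F} := [ffun i : 'I_k.+1 =>
  if unlift ord0 i is Some j then - y j else 1 + \sum_(i < k) y i].
have c0_0 : c0 ord0 = 1 + \sum_(i < k) y i by rewrite ffunE unlift_none.
have c0_S i : c0 (lift ord0 i) = - y i by rewrite ffunE liftK.
rewrite (bigD1 c0) /=; last first.
  rewrite big_ord_recl; under eq_bigr do rewrite c0_S.
  by rewrite c0_0 sumrN addrK.
rewrite [X in _ + X]big1 ?addr0 => [|c /andP[/eqP sum_c c_neq]].
  rewrite c0_0 mulrC; under eq_bigr do rewrite c0_S eqxx mulr1.
  by rewrite prodr_const card_ord.
have [c_S|] := boolP [forall i, c (lift ord0 i) == - y i]; last first.
  rewrite negb_forall => /existsP[i /negPf c_i].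
  by rewrite (bigD1 i) //= c_i mulr0 mul0r mulr0.
case/eqP: c_neq; apply/ffunP => i; case: (unliftP ord0 i) => [j|] ->.
  by rewrite c0_S; apply/eqP/(forallP c_S).
rewrite c0_0 -sum_c big_ord_recl.
under eq_bigr => j _ do rewrite (eqP (forallP c_S j)).
by rewrite sumrN subrK.
Qed.

End Orthogonality.

Lemma sorted_ord_eq n (s t : seq 'I_n) :
    sorted (fun i j : 'I_n => (i < j)%N) s ->
    sorted (fun i j : 'I_n => (i < j)%N) t -> s =i t -> s = t.
Proof.
apply: irr_sorted_eq => [j i k|i]; [exact: ltn_trans | exact: ltnn].
Qed.

Lemma sorted_filter_enum_ord n (P : pred 'I_n) :
  sorted (fun i j : 'I_n => (i < j)%N) [seq i <- enum 'I_n | P i].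
Proof.
apply: sorted_filter => [j i k|]; first exact: ltn_trans.
by have := iota_ltn_sorted 0 n; rewrite -val_enum_ord sorted_map.
Qed.

(** The list in the conclusion enumerates the support of [x] in increasing order. Strictly
    increasing lists are determined by their members, so exactly one index tuple can contribute. *)
Lemma jacobi_expansion_term (F : finFieldType) (C : numClosedFieldType)
    n (A : mchar F C) (x : 'I_n -> F) k (s : k.-tuple 'I_n) :
    sorted (fun i j : 'I_n => (i < j)%N) s ->
  1 / (#|F|%:R - 1) ^+ k *
    (delta_off C x s *
     \sum_(chi : k.-tuple (mchar F C))
       jacobi_sum [tuple of A :: [seq (psi^-1)%g | psi <- chi]] *
       \prod_(i < k) (tnth chi i) (- x (tnth s i))) =
  if tval s == [seq i <- enum 'I_n | x i != 0] then A (1 + \sum_(i < n) x i)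
  else 0.
Proof.
move=> sorted_s.
(* If [s] contains an index where [x] vanishes, every product of characters has a factor at 0. *)
have [s_neq0|] := boolP [forall i, x (tnth s i) != 0]; last first.
  rewrite negb_forall => /existsP[j]; rewrite negbK => /eqP xj0.
  rewrite ifN; last first.
    apply/eqP => Es; have := mem_tnth j s.
    by rewrite memtE Es mem_filter xj0 eqxx.
  rewrite big1 ?mulr0 // => chi _.
  by rewrite [X in _ * X](bigD1 j) //= xj0 oppr0 mchar_ext0 mul0r mulr0.
have s_supp i : i \in s -> x i != 0.
  by case/tnthP => j ->; apply: (forallP s_neq0).
(* If [s] misses a point of the support, the delta factor at that point is 0. *)
have [supp_s|] := boolP [forall i, (i \notin s) ==> (x i == 0)]; last first.
  rewrite negb_forall => /existsP[j]; rewrite negb_imply => /andP[j_s xj].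
  rewrite ifN; last first.
    apply/eqP => Es; case/negP: j_s.
    by rewrite memtE Es mem_filter xj mem_enum.
  by rewrite /delta_off (bigD1 j) //= /delta (negPf xj) mul0r mul0r mulr0.
have x0 i : i \notin s -> x i = 0 by move/(implyP (forallP supp_s i))/eqP.
have -> : tval s = [seq i <- enum 'I_n | x i != 0].
  apply: sorted_ord_eq => //; first exact: sorted_filter_enum_ord.
  move=> i; rewrite mem_filter mem_enum andbT.
  by apply/idP/idP => [/s_supp|]; last by apply: contraR => /x0 ->.
rewrite eqxx /delta_off big1 => [|i /x0 ->]; last by rewrite /delta eqxx.
rewrite !mul1r sum_jacobi_sum; last exact/forallP.
have q1_neq0 : #|F|%:R - 1 != 0 :> C.
  by rewrite subr_eq0 -[1]/(1%:R) eqr_nat gtn_eqF // card_finNzRing_gt1.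
rewrite mulKf ?expf_neq0 //; congr (A (1 + _)).
(* The entries of [s] are distinct and [x] vanishes elsewhere, so summing over [s] amounts to
   summing over all indices. *)
rewrite -(big_tuple _ _ _ xpredT) big_uniq; last first.
  apply: (sorted_uniq _ _ sorted_s) => [j i l|i]; [exact: ltn_trans | exact: ltnn].
rewrite [RHS](bigID (mem s)) /= [X in _ + X]big1 ?addr0 //.
Qed.

Theorem lemma2p3 (R : realType) (p r q : nat)
    (p_prime : prime p) (p_odd : odd p) (r_ge1 : (1 <= r)%N)
    (q_def : q = (p ^ r)%N)
    (F : finFieldType) (cardF : #|F| = q)
    (n : nat) (n_ge1 : (1 <= n)%N)
    (A : mchar F R[i]) (x : 'I_n -> F) :
  A (1 + \sum_(i < n) x i) =
    \prod_(i < n) delta R[i] (x i) +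
    \sum_(1 <= k < n.+1)
      1 / (q%:R - 1) ^+ k *
      \sum_(s : k.-tuple 'I_n | sorted (fun i j : 'I_n => (i < j)%N) s)
        delta_off R[i] x s *
        \sum_(chi : k.-tuple (mchar F R[i]))
          jacobi_sum [tuple of A :: [seq (psi^-1)%g | psi <- chi]] *
          \prod_(i < k) (tnth chi i) (- x (tnth s i)).
Proof.
rewrite -cardF; set S := [seq i <- enum 'I_n | x i != 0].
transitivity (\prod_(i < n) delta R[i] (x i) + \sum_(1 <= k < n.+1)
    \sum_(s : k.-tuple 'I_n | sorted (fun i j : 'I_n => (i < j)%N) s)
      if tval s == S then A (1 + \sum_(i < n) x i) else 0); last first.
  congr (_ + _); apply: eq_bigr => k _; rewrite mulr_sumr.
  by apply: eq_bigr => s /jacobi_expansion_term->.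
(* If [x] is identically 0, the product of deltas supplies [A 1 = 1], and the double sum vanishes
   because k starts at 1 and no tuple of positive length is empty. *)
have [S0|S_neq0] := eqVneq S [::].
  have x0 j : x j = 0.
    apply/eqP/negPn/negP => xj; have : j \in S by rewrite mem_filter xj mem_enum.
    by rewrite S0.
  rewrite [X in A (_ + X)]big1 => [|j _]; last exact: x0.
  rewrite [X in _ = X + _]big1 => [|j _]; last by rewrite /delta x0 eqxx.
  rewrite big_nat [X in _ = _ + X]big1 ?addr0 ?mchar_ext1 // => k /andP[k_gt0 _].
  rewrite big1 // => s _; rewrite ifN // S0 -size_eq0 size_tuple.
  by rewrite -lt0n.
(* Otherwise the product of deltas vanishes, and the double sum retains only k = [size S] with the
   tuple [S] itself. *)
have [j xj] : exists j, x j != 0.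
  case ES: S S_neq0 => [|j S'] // _; exists j.
  by have : j \in S; [rewrite ES mem_head | rewrite mem_filter => /andP[]].
rewrite [X in _ = X + _](bigD1 j) //= {1}/delta (negPf xj) mul0r add0r.
have S_gt0 : (0 < size S)%N by rewrite lt0n size_eq0.
have S_lt : (size S < n.+1)%N.
  by rewrite ltnS size_filter (leq_trans (count_size _ _)) // size_enum_ord.
rewrite (bigD1_seq (size S)) ?iota_uniq ?mem_index_iota ?S_gt0 //=.
rewrite [X in _ = _ + X]big1 ?addr0 => [|k k_neq]; last first.
  rewrite big1 // => s _; rewrite ifN //.
  by apply: contra k_neq => /eqP <-; rewrite size_tuple.
rewrite (bigD1 (in_tuple S)) ?sorted_filter_enum_ord //= eqxx.
rewrite [X in _ = _ + X]big1 ?addr0 // => s /andP[_ s_neq].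
by rewrite ifN.
Qed.
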